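(* Let $n\ge1$. The two indices $\mu_{RS}$ and $\mu_{RS2}$ associated to paths of symplectic matrices do not coincide in general: there exists a continuous path $\psi:[0,1]\to\mathrm{Sp}(\mathbb{R}^{2n},\Omega_0)$ such that $\mu_{RS}(\psi)\ne\mu_{RS2}(\psi)$.
   Context: $\mathrm{Sp}(\mathbb{R}^{2n},\Omega_0)=\{A : A^\tau\Omega_0A=\Omega_0\}$ with $\Omega_0=\begin{pmatrix}0&\mathrm{Id}\\-\mathrm{Id}&0\end{pmatrix}$. $\mathrm{Sign}$ of a symmetric form is the number of positive minus the number of negative eigenvalues. Robbin-Salamon index of a path of Lagrangians. Let $(E,\omega)$ be a symplectic vector space of dimension $2m$, and $\mathcal{L}_m$ its space of Lagrangian subspaces. For a smooth curve $\Lambda:[a,b]\to\mathcal{L}_m$ and $t_0\in[a,b]$, choose a Lagrangian complement $W$ of $\Lambda_{t_0}$; for $t$ near $t_0$, $\Lambda_t=\{v+\alpha_t(v): v\in\Lambda_{t_0}\}$ with $\alpha_t:\Lambda_{t_0}\to W$ linear, and $Q(\Lambda_{t_0},\dot\Lambda_{t_0})(v,v')=\frac{d}{dt}\big|_{t_0}\omega(v,\alpha_t(v'))$, a symmetric bilinear form on $\Lambda_{t_0}$ independent of $W$. Fix a reference Lagrangian $L$. A crossing is a $t$ with $\Lambda_t\cap L\ne\{0\}$; its crossing form is $\Gamma(\Lambda,L,t)=Q(\Lambda_t,\dot\Lambda_t)|_{\Lambda_t\cap L}$, and the crossing is regular if this form is nondegenerate. If $\Lambda$ has only regular crossings, $\mu_{RS}(\Lambda,L)=\frac12\mathrm{Sign}\,\Gamma(\Lambda,L,a)+\sum_{a<t<b,\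 t\text{ crossing}}\mathrm{Sign}\,\Gamma(\Lambda,L,t)+\frac12\mathrm{Sign}\,\Gamma(\Lambda,L,b)$ (an end term is $0$ if the endpoint is not a crossing). For a continuous path, $\mu_{RS}(\Lambda,L)$ is the value on any smooth path with only regular crossings homotopic to $\Lambda$ with fixed endpoints (Robbin and Salamon: such paths exist and the value does not depend on the choice). For a continuous path $\psi:[0,1]\to\mathrm{Sp}(\mathbb{R}^{2n},\Omega_0)$: $\mu_{RS}(\psi):=\mu_{RS}(\mathrm{Gr}\,\psi,\Delta)$, computed in $(\mathbb{R}^{2n}\times\mathbb{R}^{2n},\overline\Omega=-\Omega_0\oplus\Omega_0)$, with $\mathrm{Gr}\,\psi_t=\{(x,\psi_tx)\}$ and $\Delta=\{(x,x)\}$; and $\mu_{RS2}(\psi):=\mu_{RS}(\psi V,V)$, computed in $(\mathbb{R}^{2n},\Omega_0)$, where $V=\{0\}\times\mathbb{R}^n$ and $\psi V$ is the path $t\mapsto\psi_tV$. *)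

(* Defs.v *)
From HB Require Import structures.
From mathcomp Require Import all_boot all_order all_algebra.
From mathcomp Require Import all_classical all_reals all_analysis.
Set Implicit Arguments.
Unset Strict Implicit.
Unset Printing Implicit Defensive.
Import Order.TTheory GRing.Theory Num.Theory.
Import numFieldNormedType.Exports.
Local Open Scope classical_set_scope.
Local Open Scope ring_scope.

(* In what follows [w] is meant to be a symplectic form on the finite
   dimensional real vector space [E]. *)

Definition lagrangian (R : realType) (E : vectType R) (w : E -> E -> R)
    (L : {vspace E}) : Prop :=
  (\dim L).*2 = \dim {:E} /\ {in L &, forall u v, w u v = 0}.

Definition lagrangian_complement (R : realType) (E : vectType R)
    (w : E -> E -> R) (L W : {vspace E}) : Prop :=
  [/\ lagrangian w W, (L :&: W)%VS = 0%VS & (L + W)%VS = fullv].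

(* M = {v + alpha v : v in L} with alpha mapping L to W; the values of alpha
   outside L are irrelevant. *)
Definition graph_over (R : realType) (E : vectType R) (L W M : {vspace E})
    (alpha : 'End(E)) : Prop :=
  (alpha @: L <= W)%VS /\ M = ((\1 + alpha)%VF @: L)%VS.

(* Continuity at p, relatively to D, of a map into the Lagrangian Grassmannian,
   read in the graph chart alpha around Lam p given by a Lagrangian complement
   W.  As w is nondegenerate, the functions q |-> w u (alpha q v), for v in
   Lam p and u in E, determine the coordinates of alpha q on Lam p, and
   alpha p vanishes on Lam p. *)
Definition lag_continuous_at (R : realType) (E : vectType R) (w : E -> E -> R)
    (T : topologicalType) (D : set T) (Lam : T -> {vspace E}) (p : T) : Prop :=
  exists (W : {vspace E}) (alpha : T -> 'End(E)),
    [/\ lagrangian_complement w (Lam p) W,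
        (\forall q \near within D (nbhs p),
           graph_over (Lam p) W (Lam q) (alpha q)) &
        forall u v : E, v \in Lam p ->
          w u (alpha q v) @[q --> within D (nbhs p)] --> w u (alpha p v)].

(* C^infinity smoothness at t0, in the same charts. *)
Definition lag_smooth_at (R : realType) (E : vectType R) (w : E -> E -> R)
    (Lam : R -> {vspace E}) (t0 : R) : Prop :=
  exists (W : {vspace E}) (alpha : R -> 'End(E)),
    [/\ lagrangian_complement w (Lam t0) W,
        (\forall t \near t0, graph_over (Lam t0) W (Lam t) (alpha t)) &
        forall u v : E, v \in Lam t0 ->
          \forall t \near t0, forall k : nat,
            derivable (derive1n k (fun s => w u (alpha s v))) t 1].

(* A curve on [a, b] is smooth when it is the restriction of a smooth curve
   defined on an open interval containing [a, b]. *)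
Definition smooth_lag_path (R : realType) (E : vectType R) (w : E -> E -> R)
    (a b : R) (Lam : R -> {vspace E}) : Prop :=
  exists2 e : R, 0 < e & forall t : R, a - e < t < b + e ->
    lagrangian w (Lam t) /\ lag_smooth_at w Lam t.

(* Q(Lam t0, dLam/dt t0); only its values on Lam t0 are meaningful, and these do
   not depend on the choice of the Lagrangian complement W. *)
Definition is_velocity_form (R : realType) (E : vectType R) (w : E -> E -> R)
    (Lam : R -> {vspace E}) (t0 : R) (Q : E -> E -> R) : Prop :=
  exists (W : {vspace E}) (alpha : R -> 'End(E)),
    [/\ lagrangian_complement w (Lam t0) W,
        (\forall t \near t0, graph_over (Lam t0) W (Lam t) (alpha t)) &
        {in Lam t0 &, forall v v',
          is_derive t0 1 (fun t => w v (alpha t v')) (Q v v')}].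

Definition velocity_form (R : realType) (E : vectType R) (w : E -> E -> R)
    (Lam : R -> {vspace E}) (t0 : R) : E -> E -> R :=
  xget (fun _ _ => 0) [set Q | is_velocity_form w Lam t0 Q].

Definition nondegenerate_on (R : realType) (E : vectType R) (U : {vspace E})
    (B : E -> E -> R) : Prop :=
  forall u, u \in U -> {in U, forall v, B u v = 0} -> u = 0.

Definition gram_on (R : realType) (E : vectType R) (U : {vspace E})
    (B : E -> E -> R) : 'M[R]_(\dim U) :=
  \matrix_(i, j) B (tnth (vbasis U) i) (tnth (vbasis U) j).

(* The eigenvalues, repeated according to multiplicity and in some order, of a
   matrix whose characteristic polynomial splits (e.g. a symmetric one). *)
Definition eigenvalues (R : realType) (m : nat) (A : 'M[R]_m) : seq R :=
  xget [::] [set s : seq R | char_poly A = \prod_(x <- s) ('X - x%:P)].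

(* By Sylvester's law of inertia the basis used in gram_on does not matter. *)
Definition Sign_on (R : realType) (E : vectType R) (U : {vspace E})
    (B : E -> E -> R) : int :=
  let s := eigenvalues (gram_on U B) in
  (count (fun x => 0 < x) s)%:Z - (count (fun x => x < 0) s)%:Z.

Definition crossing (R : realType) (E : vectType R) (Lam : R -> {vspace E})
    (L : {vspace E}) (t : R) : bool :=
  (Lam t :&: L)%VS != 0%VS.

Definition regular_crossings (R : realType) (E : vectType R) (w : E -> E -> R)
    (a b : R) (Lam : R -> {vspace E}) (L : {vspace E}) : Prop :=
  forall t : R, a <= t <= b -> crossing Lam L t ->
    nondegenerate_on (Lam t :&: L)%VS (velocity_form w Lam t).

Definition crossing_sign (R : realType) (E : vectType R) (w : E -> E -> R)
    (Lam : R -> {vspace E}) (L : {vspace E}) (t : R) : rat :=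
  if crossing Lam L t
  then (Sign_on (Lam t :&: L)%VS (velocity_form w Lam t))%:~R
  else 0.

(* The sum is meaningful for paths with only regular crossings: these are
   isolated, hence finitely many. *)
Definition regular_index (R : realType) (E : vectType R) (w : E -> E -> R)
    (a b : R) (Lam : R -> {vspace E}) (L : {vspace E}) : rat :=
  2^-1 * crossing_sign w Lam L a
  + \sum_(t \in [set t : R | a < t < b /\ crossing Lam L t])
      crossing_sign w Lam L t
  + 2^-1 * crossing_sign w Lam L b.

(* Homotopy with fixed endpoints H (s, t), s in [0, 1], t in [a, b]. *)
Definition lag_homotopic (R : realType) (E : vectType R) (w : E -> E -> R)
    (a b : R) (Lam Lam' : R -> {vspace E}) : Prop :=
  let D := [set p : R * R | 0 <= p.1 <= 1 /\ a <= p.2 <= b] in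
  exists H : R * R -> {vspace E},
    [/\ forall p, D p -> lagrangian w (H p) /\ lag_continuous_at w D H p,
        forall t, a <= t <= b -> H (0, t) = Lam t /\ H (1, t) = Lam' t &
        forall s, 0 <= s <= 1 -> H (s, a) = Lam a /\ H (s, b) = Lam b].

(* For a continuous path Lam of Lagrangians on [a, b], the set below is a
   singleton (Robbin and Salamon). *)
Definition mu_RS_lag (R : realType) (E : vectType R) (w : E -> E -> R)
    (a b : R) (Lam : R -> {vspace E}) (L : {vspace E}) : rat :=
  xget 0 [set r : rat | exists Lam' : R -> {vspace E},
    [/\ smooth_lag_path w a b Lam', regular_crossings w a b Lam' L,
        lag_homotopic w a b Lam Lam' & r = regular_index w a b Lam' L]].

Definition Omega0 (R : realType) (n : nat) : 'M[R]_(n + n) :=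
  block_mx 0 1%:M (- 1%:M) 0.

Definition symplectic_mx (R : realType) (n : nat) (A : 'M[R]_(n + n)) : bool :=
  A^T *m Omega0 R n *m A == Omega0 R n.

Definition omega0 (R : realType) (n : nat) (u v : 'cV[R]_(n + n)) : R :=
  (u^T *m Omega0 R n *m v) 0 0.

Definition omega_bar (R : realType) (n : nat)
    (p q : 'cV[R]_(n + n) * 'cV[R]_(n + n)) : R :=
  - omega0 p.1 q.1 + omega0 p.2 q.2.

Definition Gr (R : realType) (m : nat) (A : 'M[R]_m) :
    {vspace 'cV[R]_m * 'cV[R]_m} :=
  limg (linfun (fun x : 'cV[R]_m => (x, A *m x))).

Definition diagonal (R : realType) (m : nat) : {vspace 'cV[R]_m * 'cV[R]_m} :=
  limg (linfun (fun x : 'cV[R]_m => (x, x))).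

Definition vertical (R : realType) (n : nat) : {vspace 'cV[R]_(n + n)} :=
  limg (linfun (fun y : 'cV[R]_n => col_mx (0 : 'cV[R]_n) y)).

Definition mulmx_vs (R : realType) (m : nat) (A : 'M[R]_m)
    (U : {vspace 'cV[R]_m}) : {vspace 'cV[R]_m} :=
  (linfun (mulmx A) @: U)%VS.

Definition mu_RS (R : realType) (n : nat) (psi : R -> 'M[R]_(n + n)) : rat :=
  mu_RS_lag (@omega_bar R n) 0 1 (fun t => Gr (psi t)) (diagonal R (n + n)).

Definition mu_RS2 (R : realType) (n : nat) (psi : R -> 'M[R]_(n + n)) : rat :=
  mu_RS_lag (@omega0 R n) 0 1 (fun t => mulmx_vs (psi t) (vertical R n))
    (vertical R n).

(* [linfun] returns a junk value on nonlinear functions; the next facts confirm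
   that the four subspaces above are the intended ones. *)

Lemma limg_linfunP (R : realType) (E F : vectType R) (f : E -> F) (y : F) :
  linear f -> reflect (exists x, y = f x) (y \in limg (linfun f)).
Proof.
move=> lf; pose fL : {linear E -> F} :=
  HB.pack f (GRing.isLinear.Build R E F *:%R f lf).
have fE x : linfun f x = f x := lfunE fL x.
apply: (iffP memv_imgP) => [[x _ ->]|[x ->]]; exists x; rewrite ?memvf //.
Qed.

Lemma memv_Gr (R : realType) (m : nat) (A : 'M[R]_m) p :
  (p \in Gr A) = (p.2 == A *m p.1).
Proof.
apply/limg_linfunP/eqP => [c u v|[x ->] //|pE]; last first.
  by exists p.1; rewrite -pE -surjective_pairing.
by rewrite mulmxDr -scalemxAr.
Qed.

Lemma memv_diagonal (R : realType) (m : nat) p :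
  (p \in diagonal R m) = (p.1 == p.2).
Proof.
apply/limg_linfunP/eqP => [c u v //|[x ->] //|pE].
by exists p.1; rewrite {2}pE -surjective_pairing.
Qed.

Lemma memv_vertical (R : realType) (n : nat) (u : 'cV[R]_(n + n)) :
  (u \in vertical R n) = (usubmx u == 0).
Proof.
apply/limg_linfunP/eqP => [c x y|[x ->]|uE]; last first.
- by exists (dsubmx u); rewrite -uE vsubmxK.
- exact: col_mxKu.
- by rewrite scale_col_mx add_col_mx scaler0 addr0.
Qed.

Lemma memv_mulmx_vs (R : realType) (m : nat) (A : 'M[R]_m)
    (U : {vspace 'cV[R]_m}) (u : 'cV[R]_m) :
  reflect (exists2 v, v \in U & u = A *m v) (u \in mulmx_vs A U).
Proof.
by apply: (iffP memv_imgP) => -[v vU ->]; exists v => //; rewrite lfunE.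
Qed.

(* Main.v *)
Require Import Defs.
From HB Require Import structures.
From mathcomp Require Import all_boot all_order all_algebra.
From mathcomp Require Import all_classical all_reals all_analysis.
Import Order.TTheory GRing.Theory Num.Theory.
Import numFieldNormedType.Exports.
Local Open Scope classical_set_scope.
Local Open Scope ring_scope.
Set Implicit Arguments.
Unset Strict Implicit.
Unset Printing Implicit Defensive.

(** Modulo 1, the Robbin-Salamon index of a path of Lagrangians depends only on
    its endpoints: the interior crossings contribute integers and each end
    contributes half a signature, that is, half the dimension of its
    intersection with the reference Lagrangian modulo 1 (a nondegenerate
    symmetric form on a space of dimension d has a signature of the same parity
    as d).  A homotopy fixes the endpoints, so it cannot change this class,
    and the two indices of a path of symplectic matrices already differ
    modulo 1 as soon as the endpoint dimensions have different parities.

    The path used is the matrix with blocks -1, S t, 0, -1, where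
    S t = (1 - P) + t P and P is the projector onto one coordinate axis of R^n.
    It has 1 as an eigenvalue for no t, so its graph never meets the diagonal
    and the first index is an integer ([mu_RS_lag_int]).  It maps the vertical
    Lagrangian V to { (S t y, - y) }, which meets V along the kernel of S t:
    a line for t = 0 and nothing for t <> 0.  A nondegenerate form on a line has
    signature 1 or -1, so the second index is a half-integer
    ([mu_RS_lag_not_int]).

    For this last claim the index must not be the default value 0, so some
    regular smooth representative has to exist; the path itself is one.
    Its crossing form at t = 0 is y |-> y^T P y, whichever chart computes it
    ([shear_velocity_form]); on the kernel of S 0, where P y = y, this is
    the squared norm of y. *)

(** * Signature of a nondegenerate form on a line *)

Lemma eigenvalues_dim1 (R : realType) (m : nat) (A : 'M[R]_m) :
  m = 1%N -> A != 0 -> exists2 x : R, x != 0 & eigenvalues A = [:: x].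
Proof.
move=> m1; subst m => A0; exists (A 0 0).
  apply: contraNneq A0 => A00; apply/eqP/matrixP => i j.
  by rewrite !ord1 A00 mxE.
have charA : char_poly A = \prod_(x <- [:: A 0 0]) ('X - x%:P).
  by rewrite /char_poly det_mx11 !mxE eqxx mulr1n big_seq1.
rewrite /eigenvalues; case: xgetP => [s _ /= | /(_ [:: A 0 0])]; last by case.
rewrite charA => e.
have := prod_XsubC_eq e.
by rewrite perm_sym => /perm_small_eq -> .
Qed.

Lemma Sign_on_line (R : realType) (E : vectType R) (U : {vspace E})
    (B : E -> E -> R) :
  \dim U = 1%N ->
  (forall c, {in U &, forall u v, B u (c *: v) = c * B u v}) ->
  nondegenerate_on U B ->
  exists b : bool, Sign_on U B = (-1) ^+ b.
Proof.
move=> dU BZ ndB.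
have [|x x0 xE] := eigenvalues_dim1 (A := gram_on U B) dU.
  apply/eqP => G0.
  have i0 : 'I_(\dim U) by rewrite dU; exact: ord0.
  pose e := tnth (vbasis U) i0.
  have eU : e \in U by apply: vbasis_mem; exact: mem_tnth.
  have e0 : e != 0.
    exact: free_not0 (basis_free (vbasisP U)) (mem_tnth i0 _).
  have UE : (U = <[e]>)%VS.
    by apply/eqP; rewrite eq_sym eqEdim dim_vline e0 dU -memvE eU.
  apply: (negP e0); apply/eqP; apply: (ndB e eU) => v vU.
  move: (vU); rewrite UE => /vlineP[c ->].
  rewrite BZ //; have /matrixP/(_ i0 i0) := G0.
  by rewrite !mxE => ->; rewrite mulr0.
exists (x < 0); rewrite /Sign_on xE /= !addn0.
by case: ltgtP x0 => //; rewrite ?expr0 ?expr1.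
Qed.

(** * The index modulo integers *)

Section Index.
Context (R : realType) (E : vectType R) (w : E -> E -> R).
Context (wZ : forall c u v, w u (c *: v) = c * w u v).
Implicit Types (Lam : R -> {vspace E}) (L : {vspace E}).

(** Derivation is linear; a path without velocity form gets the zero form,
    which is homogeneous as well. *)
Lemma velocity_formZ Lam t c :
  {in Lam t &, forall u v,
    velocity_form w Lam t u (c *: v) = c * velocity_form w Lam t u v}.
Proof.
move=> u v uL vL; rewrite /velocity_form; case: xgetP => [Q _ /=|_]; last first.
  by rewrite mulr0.
move=> [W [alpha [_ _ Qd]]].
have d1 := Qd u v uL vL.
have d2 := Qd u (c *: v) uL (memvZ c vL).
have d3 : is_derive t 1 (fun s => w u (alpha s (c *: v))) (c *: Q u v).
  rewrite (_ : (fun s => _) = (c \*: (fun s => w u (alpha s v)))).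
    exact: is_deriveZ.
  by apply/funext => s; rewrite linearZ wZ.
by rewrite -(@derive_val _ _ _ _ _ _ _ d2) (@derive_val _ _ _ _ _ _ _ d3).
Qed.

Lemma crossing_sign_int Lam L t : crossing_sign w Lam L t \is a Num.int.
Proof. by rewrite /crossing_sign; case: ifP => // _; rewrite intr_int. Qed.

Lemma regular_index_modZ a b Lam L :
  regular_index w a b Lam L -
    2^-1 * (crossing_sign w Lam L a + crossing_sign w Lam L b) \is a Num.int.
Proof.
rewrite /regular_index mulrDr [X in X - _]addrAC [X in X \is a _]addrC addKr.
by apply: rpred_sum => t _; exact: crossing_sign_int.
Qed.

(** A homotopy fixes the endpoints, so every representative of the path has no
    crossing there either; without any representative the index is 0. *)
Lemma mu_RS_lag_int a b Lam L :
  a <= b -> ~~ crossing Lam L a -> ~~ crossing Lam L b ->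
  mu_RS_lag w a b Lam L \is a Num.int.
Proof.
move=> ab ca cb; rewrite /mu_RS_lag; case: xgetP => [r _ /=|//].
move=> [Lam' [_ _ [H [_ H01 Hab]] ->]].
have [|_ H1a] := H01 a; first by rewrite lexx.
have [|_ H1b] := H01 b; first by rewrite lexx ab.
have [|Ha Hb] := Hab 1; first by rewrite ler01 lexx.
have La : crossing Lam' L a = false by rewrite /crossing -H1a Ha; exact: negbTE.
have Lb : crossing Lam' L b = false by rewrite /crossing -H1b Hb; exact: negbTE.
have := regular_index_modZ a b Lam' L.
by rewrite /crossing_sign La Lb addr0.
Qed.

(** Every representative starts at [Lam a], where it contributes 1/2 or -1/2,
    and gets integers elsewhere.  The hypotheses on [Lam] itself serve to
    provide one representative. *)
Lemma mu_RS_lag_not_int a b Lam L :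
  a <= b -> \dim (Lam a :&: L) = 1%N -> ~~ crossing Lam L b ->
  smooth_lag_path w a b Lam -> regular_crossings w a b Lam L ->
  lag_homotopic w a b Lam Lam ->
  mu_RS_lag w a b Lam L \isn't a Num.int.
Proof.
move=> ab da cb sL rL hL; rewrite /mu_RS_lag.
case: xgetP => [r _ /=|/(_ (regular_index w a b Lam L))]; last first.
  by case; exists Lam.
move=> [Lam' [_ rL' [H [_ H01 Hab]] ->]].
have [|_ H1a] := H01 a; first by rewrite lexx.
have [|_ H1b] := H01 b; first by rewrite lexx ab.
have [|Ha Hb] := Hab 1; first by rewrite ler01 lexx.
have La : Lam' a = Lam a by rewrite -H1a.
have Lb : Lam' b = Lam b by rewrite -H1b.
have ca : crossing Lam' L a by rewrite /crossing -dimv_eq0 La da.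
have {}cb : crossing Lam' L b = false by rewrite /crossing Lb; exact: negbTE.
have [|||e Se] := @Sign_on_line _ _ (Lam' a :&: L)%VS (velocity_form w Lam' a).
- by rewrite La.
- move=> c u v; rewrite !memv_cap => /andP[uL _] /andP[vL _].
  exact: velocity_formZ.
- by apply: rL' => //; rewrite lexx.
have := regular_index_modZ a b Lam' L.
rewrite /crossing_sign ca cb addr0 Se => k1; apply/negP => k2.
have := rpredB k2 k1; rewrite subKr.
by case: (e).
Qed.
End Index.

(** * Analysis in the charts *)

(** The definition of a velocity form controls [w v (alpha t u)] for v in
    [Lam t0] only.  As W is isotropic and contains the values of [alpha t], the
    W-component of an arbitrary v does not matter, so the control extends to
    every v. *)
Lemma chart_cvg0 (R : realType) (E : vectType R) (w : E -> E -> R)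
    (wDl : forall v v' u, w (v + v') u = w v u + w v' u)
    (w0r : forall v, w v 0 = 0)
    (Lam : R -> {vspace E}) (t0 : R) (W : {vspace E}) (alpha : R -> 'End(E)) :
  lagrangian_complement w (Lam t0) W ->
  (\forall t \near t0, graph_over (Lam t0) W (Lam t) (alpha t)) ->
  {in Lam t0 &, forall v u, derivable (fun t => w v (alpha t u)) t0 1} ->
  forall v u, u \in Lam t0 -> w v (alpha t u) @[t --> t0] --> 0.
Proof.
move=> [[_ isoW] capW addW] graph_alpha diff_alpha v u uL.
have alpha_t0 : alpha t0 u = 0.
  have [/subvP aW aL] := nbhs_singleton graph_alpha.
  apply/eqP; rewrite -memv0 -capW memv_cap aW ?memv_img // andbT.
  rewrite -[alpha t0 u](addKr u) memvD ?memvN //.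
  by rewrite aL; apply/memv_imgP; exists u; rewrite // add_lfunE id_lfunE.
have /memv_addP[v1 v1L [v2 v2W ->]] : v \in (Lam t0 + W)%VS.
  by rewrite addW memvf.
have cv1 : w v1 (alpha t u) @[t --> t0] --> (0 : R).
  rewrite -(w0r v1) -alpha_t0.
  apply: (@differentiable_continuous _ _ _ t0 (fun t => w v1 (alpha t u))).
  by apply/derivable1_diffP; exact: diff_alpha.
apply: cvg_trans cv1; apply: near_eq_cvg.
near=> t; rewrite wDl (isoW v2) ?addr0 //.
have [/subvP aW _] : graph_over (Lam t0) W (Lam t) (alpha t) by near: t.
by apply: aW; rewrite memv_img.
Unshelve. all: by end_near. Qed.

Lemma is_derive_affine (R : realType) (a b t : R) :
  is_derive t 1 (fun t : R => t * a + b) a.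
Proof.
have -> : (fun t : R => t * a + b) = (id * cst a) + cst b by [].
apply: is_derive_eq.
by rewrite /= scaler0 add0r addr0 /GRing.scale/= mulr1.
Qed.

Lemma derive1n_affine (R : realType) (a b : R) (k : nat) :
  exists a' b' : R, derive1n k (fun t : R => t * a + b) = fun t => t * a' + b'.
Proof.
elim: k => [|k [a' [b' IH]]]; first by exists a, b.
exists 0, a'; rewrite derive1nS IH; apply/funext => t.
rewrite derive1E mulr0 add0r.
exact: (@derive_val _ _ _ _ _ _ _ (is_derive_affine a' b' t)).
Qed.

(** * Symplectic linear algebra *)

Section Symplectic.
Context (R : realType) (n : nat).
Implicit Types (A S P : 'M[R]_n) (x y : 'cV[R]_n) (u v : 'cV[R]_(n + n)).

Lemma omega0E u v :
  omega0 u v = ((usubmx u)^T *m dsubmx v - (dsubmx u)^T *m usubmx v) 0 0.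
Proof.
rewrite /omega0 -{1}[u]vsubmxK -{1}[v]vsubmxK tr_col_mx /Omega0 mul_row_block.
by rewrite mul_row_col !mulmx0 !mulmx1 mulmxN mulmx1 add0r addr0 mulNmx addrC.
Qed.

Lemma omega0Zr (c : R) u v : omega0 u (c *: v) = c * omega0 u v.
Proof. by rewrite /omega0 -scalemxAr mxE. Qed.

Lemma omega0Dl u u' v : omega0 (u + u') v = omega0 u v + omega0 u' v.
Proof. by rewrite /omega0 linearD /= !mulmxDl mxE. Qed.

Lemma omega0Dr u v v' : omega0 u (v + v') = omega0 u v + omega0 u v'.
Proof. by rewrite /omega0 mulmxDr mxE. Qed.

Lemma symplectic_Omega0 : symplectic_mx (Omega0 R n).
Proof.
rewrite /symplectic_mx /Omega0 tr_block_mx !mulmx_block !linearN /= !linear0.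
by rewrite trmx1 !(mul0mx, mulmx0, mulmx1, mul1mx, mulNmx, mulmxN, add0r, addr0)
  opprK !oppr0.
Qed.

Lemma symplectic_unit (A : 'M[R]_(n + n)) : symplectic_mx A -> A \in unitmx.
Proof.
have uO : Omega0 R n \in unitmx.
  have OO : Omega0 R n *m (- Omega0 R n) = 1%:M.
    rewrite mulmxN /Omega0 mulmx_block.
    rewrite !(mul0mx, mulmx0, mulmx1, mulmxN, mul1mx).
    by rewrite !(add0r, addr0) opp_block_mx !oppr0 !opprK -scalar_mx_block.
  by case: (mulmx1_unit OO).
move=> /eqP sA; move: uO; rewrite -sA !unitmxE !det_mulmx.
by rewrite !unitrM => /andP[].
Qed.

Lemma omega0_symplectic (A : 'M[R]_(n + n)) u v :
  symplectic_mx A -> omega0 (A *m u) (A *m v) = omega0 u v.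
Proof.
move=> /eqP sA; rewrite /omega0 trmx_mul -!mulmxA (mulmxA (Omega0 _ _)).
by rewrite (mulmxA A^T) (mulmxA A^T) sA.
Qed.

Lemma linear_col_mx0 : linear (fun y : 'cV[R]_n => col_mx (0 : 'cV[R]_n) y).
Proof. by move=> c x y; rewrite scale_col_mx add_col_mx scaler0 addr0. Qed.

Lemma dim_vertical : \dim (vertical R n) = n.
Proof.
rewrite /vertical limg_dim_eq ?dimvf ?dim_matrix; first exact: muln1.
apply/eqP; rewrite -subv0; apply/subvP => y.
rewrite memv_cap memvf memv_ker /= memv0.
pose f : {linear 'cV[R]_n -> 'cV[R]_(n + n)} :=
  HB.pack (fun y : 'cV[R]_n => col_mx (0 : 'cV[R]_n) y)
    (GRing.isLinear.Build _ _ _ _ (fun y : 'cV[R]_n => col_mx (0 : 'cV[R]_n) y)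
       linear_col_mx0).
rewrite (lfunE f) /= => /eqP/(congr1 dsubmx); rewrite col_mxKd => ->.
by rewrite linear0.
Qed.

Lemma lagrangian_symplectic_image (A : 'M[R]_(n + n)) :
  symplectic_mx A -> lagrangian (@omega0 R n) (mulmx_vs A (vertical R n)).
Proof.
move=> sA; split.
  have -> : \dim {:'cV[R]_(n + n)} = n.*2.
    by rewrite dimvf dim_matrix -addnn; exact: muln1.
  rewrite /mulmx_vs limg_dim_eq ?dim_vertical //.
  apply/eqP; rewrite -subv0; apply/subvP => y; rewrite memv_cap memv_ker lfunE.
  move=> /andP[_ /eqP/= Ay]; rewrite memv0 -(mulKmx (symplectic_unit sA) y).
  by rewrite Ay mulmx0.
move=> _ _ /memv_mulmx_vs[x xV ->] /memv_mulmx_vs[y yV ->].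
rewrite omega0_symplectic // omega0E.
move: xV yV; rewrite !memv_vertical => /eqP-> /eqP->.
by rewrite mulmx0 linear0 mul0mx subrr mxE.
Qed.

(** * Lagrangians that are graphs over the vertical one *)

(** The opposite of a symplectic shear: the sign removes the eigenvalue 1 and
    does not affect the images of subspaces. *)
Definition neg_shear S : 'M[R]_(n + n) := block_mx (- 1%:M) S 0 (- 1%:M).

Lemma symplectic_neg_shear S : S^T = S -> symplectic_mx (neg_shear S).
Proof.
move=> Ssym; rewrite /symplectic_mx /Omega0 /neg_shear tr_block_mx !mulmx_block.
rewrite Ssym !linearN /= !linear0 trmx1.
rewrite !(mul0mx, mulmx0, mulmx1, mul1mx, mulNmx, mulmxN, add0r, addr0).
by rewrite !opprK !oppr0 add0r subrr.
Qed.

Lemma neg_shear_fix S u : neg_shear S *m u = u -> u = 0.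
Proof.
have no_fix y : - y = y -> y = 0.
  move=> /eqP; rewrite eq_sym -addr_eq0 -mulr2n -scaler_nat scaler_eq0.
  by rewrite pnatr_eq0 /= => /eqP.
rewrite -{1 2}[u]vsubmxK /neg_shear mul_block_col !mulNmx !mul1mx mul0mx add0r.
move=> /eq_col_mx[eu ed]; have d0 := no_fix _ ed.
by rewrite d0 mulmx0 addr0 in eu; rewrite -[u]vsubmxK d0 (no_fix _ eu) col_mx0.
Qed.

Lemma memv_neg_shear S u :
  (u \in mulmx_vs (neg_shear S) (vertical R n)) =
  (usubmx u == - (S *m dsubmx u)).
Proof.
apply/memv_mulmx_vs/eqP => [[v vV ->]|uE].
  move: vV; rewrite memv_vertical => /eqP v0.
  rewrite -[v]vsubmxK v0 /neg_shear mul_block_col col_mxKu col_mxKd !mulNmx.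
  by rewrite mulmx0 mul0mx mul1mx add0r oppr0 add0r mulmxN opprK.
exists (col_mx 0 (- dsubmx u)); first by rewrite memv_vertical col_mxKu.
rewrite /neg_shear mul_block_col !mulmx0 !add0r mulNmx mul1mx opprK mulmxN.
by rewrite -uE vsubmxK.
Qed.

(** [Omega0] exchanges the vertical and the horizontal Lagrangians. *)
Lemma memv_horizontal u :
  (u \in mulmx_vs (Omega0 R n) (vertical R n)) = (dsubmx u == 0).
Proof.
apply/memv_mulmx_vs/eqP => [[v vV ->]|uE].
  move: vV; rewrite memv_vertical => /eqP v0.
  by rewrite -[v]vsubmxK v0 /Omega0 mul_block_col col_mxKd mulmx0 mul0mx addr0.
exists (col_mx 0 (usubmx u)); first by rewrite memv_vertical col_mxKu.
rewrite /Omega0 mul_block_col !mulmx0 mul0mx add0r addr0 mul1mx.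
by rewrite -[LHS]vsubmxK uE.
Qed.

Lemma horizontal_complement S : S^T = S ->
  lagrangian_complement (@omega0 R n) (mulmx_vs (neg_shear S) (vertical R n))
    (mulmx_vs (Omega0 R n) (vertical R n)).
Proof.
move=> Ssym; split.
- exact/lagrangian_symplectic_image/symplectic_Omega0.
- apply/eqP; rewrite -subv0; apply/subvP => u; rewrite memv_cap memv_neg_shear.
  rewrite memv_horizontal memv0 => /andP[/eqP uE /eqP d0].
  by rewrite -[u]vsubmxK uE d0 mulmx0 oppr0 col_mx0.
- apply/eqP; rewrite eqEsubv subvf; apply/subvP => u _; apply/memv_addP.
  exists (col_mx (- (S *m dsubmx u)) (dsubmx u)).
    by rewrite memv_neg_shear col_mxKu col_mxKd.
  exists (col_mx (usubmx u + S *m dsubmx u) 0).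
    by rewrite memv_horizontal col_mxKd.
  by rewrite add_col_mx addr0 addrCA addNr addr0 vsubmxK.
Qed.

(** Every image of the vertical Lagrangian by a [neg_shear] is a graph in the
    chart given by any other one and the horizontal complement; the chart is
    affine in the shear, which makes smoothness and continuity elementary. *)
Definition shear_chart (D : 'M[R]_n) : 'End('cV[R]_(n + n)) :=
  linfun (mulmx (block_mx 0 (- D) 0 0 : 'M[R]_(n + n))).

Lemma shear_chartE D u : shear_chart D u = col_mx (- (D *m dsubmx u)) 0.
Proof.
rewrite lfunE /= -{1}[u]vsubmxK mul_block_col.
by rewrite !mul0mx add0r addr0 mulNmx.
Qed.

Lemma graph_over_shear_chart S S' :
  graph_over (mulmx_vs (neg_shear S) (vertical R n))
    (mulmx_vs (Omega0 R n) (vertical R n))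
    (mulmx_vs (neg_shear S') (vertical R n)) (shear_chart (S' - S)).
Proof.
split.
  apply/subvP => _ /memv_imgP[u _ ->].
  by rewrite shear_chartE memv_horizontal col_mxKd.
apply/vspaceP => u; rewrite memv_neg_shear.
apply/eqP/memv_imgP => [uE|[v vL ->]].
  exists (col_mx (- (S *m dsubmx u)) (dsubmx u)).
    by rewrite memv_neg_shear col_mxKu col_mxKd.
  rewrite add_lfunE id_lfunE shear_chartE col_mxKd add_col_mx addr0 -opprD.
  by rewrite -mulmxDl addrCA subrr addr0 -uE vsubmxK.
move: vL; rewrite memv_neg_shear => /eqP vE.
rewrite add_lfunE id_lfunE shear_chartE !linearD /=.
rewrite col_mxKu col_mxKd mulmx0 subr0 vE.
by rewrite -opprD -mulmxDl addrCA subrr addr0.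
Qed.

(** * Affine paths of shears *)

Definition pencil A P (t : R) : 'M[R]_n := A + t *: P.

Definition shear_path A P (t : R) : {vspace 'cV[R]_(n + n)} :=
  mulmx_vs (neg_shear (pencil A P t)) (vertical R n).

Section Pencil.
Context (A P : 'M[R]_n) (Asym : A^T = A) (Psym : P^T = P).

Lemma pencil_sym t : (pencil A P t)^T = pencil A P t.
Proof. by rewrite /pencil linearD linearZ /= Asym Psym. Qed.

Lemma pencil_shear_chart t t0 u v :
  omega0 u (shear_chart (pencil A P t - pencil A P t0) v) =
  t * omega0 u (shear_chart P v) + - t0 * omega0 u (shear_chart P v).
Proof.
rewrite /pencil opprD addrACA subrr add0r -scalerBl -mulrDl -omega0Zr.
rewrite !shear_chartE -scalemxAl -scalerN; congr (omega0 u _).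
by rewrite scale_col_mx scaler0.
Qed.

Lemma shear_path_lagrangian t : lagrangian (@omega0 R n) (shear_path A P t).
Proof.
exact/lagrangian_symplectic_image/symplectic_neg_shear/pencil_sym.
Qed.

Lemma shear_path_smooth a b :
  smooth_lag_path (@omega0 R n) a b (shear_path A P).
Proof.
exists 1 => // t0 _; split; first exact: shear_path_lagrangian.
exists (mulmx_vs (Omega0 R n) (vertical R n)),
  (fun t => shear_chart (pencil A P t - pencil A P t0)).
split.
- exact/horizontal_complement/pencil_sym.
- by apply: (@filterE _ _ (nbhs_filter t0)) => t; exact: graph_over_shear_chart.
- move=> u v _; apply: (@filterE _ _ (nbhs_filter t0)) => t k.
  rewrite (_ : (fun s => _) = (fun s : R => s * omega0 u (shear_chart P v) +
    - t0 * omega0 u (shear_chart P v))); last first.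
    by apply/funext => s; exact: pencil_shear_chart.
  have [a' [b' ->]] := derive1n_affine (omega0 u (shear_chart P v))
    (- t0 * omega0 u (shear_chart P v)) k.
  exact: (@ex_derive _ _ _ _ _ _ _ (is_derive_affine a' b' t)).
Qed.

Lemma shear_path_homotopic a b :
  lag_homotopic (@omega0 R n) a b (shear_path A P) (shear_path A P).
Proof.
exists (fun p => shear_path A P p.2); split => // p _.
split; first exact: shear_path_lagrangian.
exists (mulmx_vs (Omega0 R n) (vertical R n)),
  (fun q => shear_chart (pencil A P q.2 - pencil A P p.2)).
split.
- exact/horizontal_complement/pencil_sym.
- by apply: nearW => t; exact: graph_over_shear_chart.
- move=> u v _.
  have cont :
    omega0 u (shear_chart (pencil A P q.2 - pencil A P p.2) v) @[q --> p]
      --> omega0 u (shear_chart (pencil A P p.2 - pencil A P p.2) v).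
    rewrite pencil_shear_chart; under eq_fun do rewrite pencil_shear_chart.
    apply: cvgD; last exact: cvg_cst.
    by apply: cvgM; [exact: cvg_snd|exact: cvg_cst].
  exact: cvg_trans (cvg_app _ (cvg_within _)) cont.
Qed.

Lemma neg_shear_pencil_continuous :
  continuous (fun t => neg_shear (pencil A P t)).
Proof.
move=> t.
have -> : (fun t => neg_shear (pencil A P t)) =
    (fun t => neg_shear A + t *: block_mx 0 P 0 0).
  apply/funext => s; rewrite scale_block_mx !scaler0 add_block_mx !addr0.
  by [].
by apply: cvgD; [exact: cvg_cst|apply: cvgZr_tmp; exact: cvg_id].
Qed.

Lemma shear_has_velocity_form t0 :
  is_velocity_form (@omega0 R n) (shear_path A P) t0
    (fun u v => omega0 u (shear_chart P v)).
Proof.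
exists (mulmx_vs (Omega0 R n) (vertical R n)),
  (fun t => shear_chart (pencil A P t - pencil A P t0)).
split.
- exact/horizontal_complement/pencil_sym.
- by apply: (@filterE _ _ (nbhs_filter t0)) => t; exact: graph_over_shear_chart.
- move=> u v _ _; under eq_fun do rewrite pencil_shear_chart.
  exact: is_derive_affine.
Qed.

(** Let u = (0, y) and z = u + alpha t u, a point of the path at time t, that
    is z = (- (A + t P) d, d).  As A y = 0, both omega0 u z = t (P y)^T d and
    omega0 v z = (P y)^T d for v = (P y, 0), so that
    omega0 u (alpha t u) = t (omega0 v (alpha t u) + y^T P y).  The inner
    term tends to 0 by [chart_cvg0], which gives the derivative at 0 in every
    chart. *)
Lemma shear_velocity_form Q y :
  is_velocity_form (@omega0 R n) (shear_path A P) 0 Q -> A *m y = 0 ->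
  Q (col_mx 0 y) (col_mx 0 y) = (y^T *m P *m y) 0 0.
Proof.
move=> [W [alpha [complW graphW dQ]]] Ay.
set u := col_mx 0 y; set b := (_ *m y) 0 0.
have uL : u \in shear_path A P 0.
  by rewrite memv_neg_shear col_mxKu col_mxKd /pencil scale0r addr0 Ay oppr0.
pose v : 'cV[R]_(n + n) := col_mx (P *m y) 0.
have g0 : omega0 v (alpha t u) @[t --> 0] --> (0 : R).
  apply: (chart_cvg0 omega0Dl _ complW) => //.
    by move=> ?; rewrite /omega0 mulmx0 mxE.
  by move=> x x' xL x'L; have [] := dQ x x' xL x'L.
have fE : \forall t \near (0 : R),
    omega0 u (alpha t u) = t * (omega0 v (alpha t u) + b).
  near=> t.
  have [_ LE] : graph_over (shear_path A P 0) W (shear_path A P t) (alpha t).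
    by near: t.
  have [z zL ->] :
      exists2 z, z \in shear_path A P t & alpha t u = z + (-1) *: u.
    exists (u + alpha t u); last by rewrite scaleN1r addrC addKr.
    by rewrite LE; apply/memv_imgP; exists u; rewrite // add_lfunE id_lfunE.
  move: zL; rewrite memv_neg_shear => /eqP zE.
  rewrite !omega0Dr !omega0Zr !omega0E zE /u /v !col_mxKu !col_mxKd.
  have SyE : y^T *m pencil A P t = t *: (P *m y)^T.
    rewrite -[LHS]trmxK trmx_mul trmxK pencil_sym /pencil mulmxDl Ay add0r.
    by rewrite -scalemxAl linearZ.
  rewrite trmx0 !mul0mx !mulmx0 !subr0 !sub0r mulmxN opprK mulmxA SyE.
  rewrite -scalemxAl [X in X + _]mxE [X in _ + -1 * X]mxE mulr0 addr0.
  rewrite trmx_mul Psym -/b.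
  by rewrite mulN1r subrK.
have dQu := dQ u u uL uL.
rewrite -(@derive_val _ _ _ _ _ _ _ dQu); apply: cvg_lim => //.
have cb : omega0 v (alpha h u) + b @[h --> 0^'] --> b.
  rewrite -[X in _ --> X]add0r; apply: cvgD; last exact: cvg_cst.
  by apply: cvg_trans g0; apply: cvg_app; exact: nbhs_dnbhs.
apply: cvg_trans cb; apply: near_eq_cvg.
have f0 := nbhs_singleton fE; rewrite mul0r in f0.
near=> h; rewrite /= f0 subr0 addr0 /GRing.scale /= mulr1.
have -> : omega0 u (alpha h u) = h * (omega0 v (alpha h u) + b).
  by near: h; exact: nbhs_dnbhs.
by rewrite mulKf //; near: h; exact: nbhs_dnbhs_neq.
Unshelve. all: by end_near. Qed.
End Pencil.

(** * Crossings of the path *)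

Lemma sqr_norm_eq0 y : (y^T *m y) 0 0 = 0 -> y = 0.
Proof.
rewrite mxE => /psumr_eq0P h; apply/colP => i; rewrite mxE.
have /(_ i isT)/eqP : forall j, true -> y^T 0 j * y j 0 = 0.
  by apply: h => j _; rewrite mxE -expr2 sqr_ge0.
by rewrite mxE mulf_eq0 orbb => /eqP.
Qed.

Lemma neg_shear_image_vertical S u :
  u \in (mulmx_vs (neg_shear S) (vertical R n) :&: vertical R n)%VS ->
  u = col_mx 0 (dsubmx u) /\ S *m dsubmx u = 0.
Proof.
rewrite memv_cap memv_neg_shear memv_vertical => /andP[/eqP uE /eqP u0].
split; first by rewrite -{1}[u]vsubmxK u0.
by apply/eqP; rewrite -oppr_eq0 -uE u0.
Qed.

Lemma crossing_graph_diagonal (S : R -> 'M[R]_n) t :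
  ~~ crossing (fun t => Gr (neg_shear (S t))) (Defs.diagonal R (n + n)) t.
Proof.
rewrite /crossing negbK -subv0; apply/subvP => -[p q].
rewrite memv_cap memv_Gr memv_diagonal /= => /andP[/eqP qE /eqP pq].
have p0 : p = 0 by apply: (@neg_shear_fix (S t)); rewrite -qE pq.
by rewrite memv0 -pq p0.
Qed.

Section ProjectorPencil.
Context (P : 'M[R]_n) (Psym : P^T = P) (Pidem : P *m P = P).

Lemma coprojector_sym : (1%:M - P)^T = 1%:M - P.
Proof. by rewrite linearB /= trmx1 Psym. Qed.

Lemma coprojector_ker y : (1%:M - P) *m y = 0 -> P *m y = y.
Proof. by rewrite mulmxBl mul1mx => /eqP; rewrite subr_eq0 eq_sym => /eqP. Qed.

Lemma projector_pencil_inj t y :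
  t != 0 -> pencil (1%:M - P) P t *m y = 0 -> y = 0.
Proof.
move=> t0 Sy; have Py : P *m y = 0.
  have : P *m (pencil (1%:M - P) P t *m y) = 0 by rewrite Sy mulmx0.
  rewrite mulmxA /pencil mulmxDr mulmxBr mulmx1 -scalemxAr Pidem subrr add0r.
  by rewrite -scalemxAl => /eqP; rewrite scaler_eq0 (negbTE t0) => /eqP.
move: Sy; rewrite /pencil mulmxDl mulmxBl mul1mx -scalemxAl Py scaler0.
by rewrite subr0 addr0.
Qed.

Lemma projector_shear_crossing t :
  crossing (shear_path (1%:M - P) P) (vertical R n) t -> t = 0.
Proof.
move=> ct; apply: contraTeq ct => t0; rewrite negbK -subv0; apply/subvP => u.
move=> /neg_shear_image_vertical[uE /(projector_pencil_inj t0) d0].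
by rewrite memv0 uE d0 col_mx0.
Qed.

(** At the only crossing the form is the squared norm, hence definite. *)
Lemma projector_shear_regular a b :
  regular_crossings (@omega0 R n) a b (shear_path (1%:M - P) P) (vertical R n).
Proof.
move=> t _ /projector_shear_crossing-> u uU; rewrite /velocity_form.
have [uE] := neg_shear_image_vertical uU.
rewrite /pencil scale0r addr0 => Su /(_ u uU).
case: xgetP => [Q _ Qv|noQ]; last first.
  by have := noQ _ (shear_has_velocity_form coprojector_sym Psym 0).
rewrite uE (shear_velocity_form coprojector_sym Psym Qv Su).
by rewrite -mulmxA (coprojector_ker Su) => /sqr_norm_eq0 ->; rewrite col_mx0.
Qed.
End ProjectorPencil.

Lemma dim_coordinate_shear_vertical
    (i0 : 'I_n) (P := delta_mx i0 i0 : 'M[R]_n) :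
  \dim (shear_path (1%:M - P) P 0 :&: vertical R n) = 1%N.
Proof.
pose e : 'cV[R]_(n + n) := col_mx 0 (delta_mx i0 0).
have e0 : e != 0.
  apply/eqP => /(congr1 dsubmx); rewrite col_mxKd linear0 => /colP/(_ i0)/eqP.
  by rewrite !mxE !eqxx oner_eq0.
suff -> : (shear_path (1%:M - P) P 0 :&: vertical R n)%VS = <[e]>%VS.
  by rewrite dim_vline e0.
have S0 : pencil (1%:M - P) P 0 = 1%:M - P by rewrite /pencil scale0r addr0.
apply/eqP; rewrite eqEsubv; apply/andP; split.
  apply/subvP => u /neg_shear_image_vertical[uE].
  rewrite S0 => /coprojector_ker dE; apply/vlineP.
  exists (dsubmx u i0 0); rewrite [LHS]uE -{1}dE scale_col_mx scaler0.
  congr col_mx; apply/colP => i; rewrite !mxE (bigD1 i0) //= big1 ?addr0.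
    by rewrite !mxE !eqxx !andbT mulrC.
  by move=> j ji; rewrite mxE (negbTE ji) andbF mul0r.
rewrite -memvE memv_cap memv_neg_shear memv_vertical col_mxKu col_mxKd S0.
by rewrite mulmxBl mul1mx mul_delta_mx subrr oppr0 !eqxx.
Qed.
End Symplectic.

Theorem proposition58 (R : realType) (n : nat) (hn : (1 <= n)%N) :
  exists psi : R -> 'M[R]_(n + n),
    [/\ {within `[0, 1]%classic, continuous psi},
        (forall t : R, 0 <= t <= 1 -> symplectic_mx (psi t)) &
        mu_RS psi <> mu_RS2 psi].
Proof.
pose i0 := Ordinal hn; pose P : 'M[R]_n := delta_mx i0 i0.
have Psym : P^T = P by exact: trmx_delta.
have Pidem : P *m P = P by exact: mul_delta_mx.
have Asym := coprojector_sym Psym.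
exists (fun t => neg_shear (pencil (1%:M - P) P t)); split.
- exact/continuous_subspaceT/neg_shear_pencil_continuous.
- by move=> t _; apply/symplectic_neg_shear/pencil_sym.
move=> eq12.
have := @mu_RS_lag_int _ _ (@omega_bar R n) 0 1
  (fun t => Gr (neg_shear (pencil (1%:M - P) P t))) _ ler01
  (crossing_graph_diagonal _ 0) (crossing_graph_diagonal _ 1).
rewrite -/(mu_RS _) eq12; apply/negP.
apply: mu_RS_lag_not_int.
- exact: omega0Zr.
- exact: ler01.
- exact: dim_coordinate_shear_vertical.
- by apply/negP => /(projector_shear_crossing Pidem)/eqP; rewrite oner_eq0.
- exact: shear_path_smooth.
- exact: projector_shear_regular.
- exact: shear_path_homotopic.
Qed.
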